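(* Let $A=\{1,2,3\}$ and let $n,d,e\in\mathbb{N}$ be such that both players are middle class, i.e. $M_1(n)\le d<U_1(n)$ and $M_2(n)\le e<U_2(n)$. Then the winner of $\mathrm{NIM}(A;n;d,e)$ is determined as follows. 1. $n\equiv 0\pmod 4$: - for every integer $k\ge 0$: if $M_1(n)+k\le d<M_1(n)+k+1$ and $e<M_2(n)+k+1$, then $W(n;d,e)=1$; if $M_1(n)+k\le d<M_1(n)+k+1$ and $e\ge M_2(n)+k+1$, then $W(n;d,e)=2$; - if $d\ge U_1(n)-1$ and $e<U_2(n)-1$, then $W(n;d,e)=1$; if $d\ge U_1(n)-1$ and $e\ge U_2(n)-1$, then $W(n;d,e)=2$. 2. $n\equiv 1,3\pmod 4$: - if $d<M_1(n)+1$, then $W(n;d,e)=2$; - for every integer $k\ge 0$: if $M_1(n)+k+1\le d<M_1(n)+k+2$ and $e<M_2(n)+k+1$, then $W(n;d,e)=1$; if $M_1(n)+k+1\le d<M_1(n)+k+2$ and $e\ge M_2(n)+k+1$, then $W(n;d,e)=2$; - if $d\ge U_1(n)-1$, then $W(n;d,e)=1$. 3. $n\equiv 2\pmod 4$: - for every integer $k\ge 0$: if $M_1(n)+k\le d<M_1(n)+k+1$ and $e<M_2(n)+k+1$, then $W(n;d,e)=1$; if $M_1(n)+k\le d<M_1(n)+k+1$ and $e\ge M_2(n)+k+1$, then $W(n;d,e)=2$; - if $d\ge U_1(n)-1$, then $W(n;d,e)=1$.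
   Context: $\mathbb{N}=\{0,1,2,\dots\}$. In the game $\mathrm{NIM}(A;n)$ two players alternate (Player 1 first) removing some $a\in A$ stones from a pile of $n$ stones ($a$ may not exceed the number of stones left); a player who cannot move loses. $W(n)\in\{1,2\}$ is the player with a winning strategy. In the NIM with Cash game $\mathrm{NIM}(A;n;d,e)$, Player 1 starts with $d$ dollars and Player 2 with $e$ dollars. Players alternate, Player 1 first; a move consists of removing some $a\in A$ stones and paying $a$ dollars, where $a$ may exceed neither the number of stones left nor the mover's money. A player who cannot move on his turn loses. $W(n;d,e)\in\{1,2\}$ is the player with a winning strategy. The upper class amounts $U_1(n),U_2(n)\in\mathbb{N}$ are defined recursively (depending on $A$): - If $n<\min(A)$, then $U_1(n)=U_2(n)=0$. - If $n\ge\min(A)$ and $W(n)=1$, then $U_1(n)=\min\{U_2(n-a)+a : a\in A,\ a\le n,\ W(n-a)=2\}$ and $U_2(n)=\max\{U_1(n-a): a\in A,\ a\le n\}$. - If $n\ge\min(A)$ and $W(n)=2$, then $U_2(n)=\max\{U_1(n-a): a\in A,\ a\le n\}$ and $U_1(n)=\min\{U_2(n-a)+a : a\in A,\ a\le n,\ U_1(n-a)=U_2(n)\}$. The middle class thresholds are $M_1(n)=\frac n2+1$, $M_2(n)=\frac n2$ for $n$ even, and $M_1(n)=M_2(n)=\frac{n+1}{2}$ for $n$ odd. Player $i$ is middle class when his money is at least $M_i(n)$ and less than $U_i(n)$. *)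

(* Defs.v *)
From HB Require Import structures.
From mathcomp Require Import all_boot.

Set Implicit Arguments.
Unset Strict Implicit.
Unset Printing Implicit Defensive.

Inductive player := Player1 | Player2.

Definition opponent (i : player) : player :=
  if i is Player1 then Player2 else Player1.

Definition is_player1 (i : player) : bool := if i is Player1 then true else false.
Definition player_of_bool (b : bool) : player := if b then Player1 else Player2.
Lemma is_player1K : cancel is_player1 player_of_bool. Proof. by case. Qed.
HB.instance Definition _ := Equality.copy player (can_type is_player1K).

(* Finite alternating games in which a player who cannot move on his turn
   loses.  Moves are named by natural numbers (here, numbers of stones); the
   measure rules out infinite plays. *)
Record game := Game {
  position :> Type;
  turn : position -> player;
  moves : position -> seq nat;
  next : position -> nat -> position;
  measure : position -> nat;
  turn_next : forall x a, turn (next x a) = opponent (turn x);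
  measure_next : forall x a, a \in moves x -> measure (next x a) < measure x
}.

Section Strategies.
Variable G : game.
Implicit Types (x : G) (h : seq nat) (i : player).

Definition run x h : G := foldl (@next G) x h.

Fixpoint legal_play x h : bool :=
  if h is a :: h' then (a \in moves x) && legal_play (next x a) h' else true.

(* A strategy chooses a move from the list of all moves made so far, in
   chronological order. *)
Definition strategy := seq nat -> nat.

Definition follows (s : strategy) i x h : Prop :=
  forall h1 a h2, h = h1 ++ a :: h2 -> turn (run x h1) = i -> a = s h1.

(* The strategy of player i gives a legal move whenever i has one, and every
   finished play in which i uses it ends with the opponent unable to move. *)
Definition winning_strategy (s : strategy) i x : Prop :=
  forall h, legal_play x h -> follows s i x h ->
    (turn (run x h) = i -> moves (run x h) <> [::] ->
       s h \in moves (run x h)) /\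
    (moves (run x h) = [::] -> turn (run x h) = opponent i).

Lemma followsS s i x a h :
  follows s i x (a :: h) <->
  (turn x = i -> a = s [::]) /\ follows (fun g => s (a :: g)) i (next x a) h.
Proof.
split=> [F | [F0 F] [|b h1] c h2].
- split=> [tx | h1 b h2 Eh]; first exact: (F [::] a h).
  by move=> t; apply: (F (a :: h1) b h2) => //; rewrite Eh.
- by case=> <- _ tx; apply: F0.
- by case=> <- Eh tx; apply: (F h1 c h2).
Qed.

Lemma winning_next s i x a : winning_strategy s i x ->
    a \in moves x -> (turn x = i -> a = s [::]) ->
  winning_strategy (fun g => s (a :: g)) i (next x a).
Proof.
move=> w ma ea h lh fh; apply: (w (a :: h)); first by rewrite /= ma.
by apply/followsS.
Qed.

Lemma opponent_neq i : i <> opponent i. Proof. by case: i. Qed.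
Lemma neq_opponent i j : i <> j -> i = opponent j. Proof. by case: i; case: j. Qed.

Lemma winning_here s i x : turn x = i ->
    s [::] \in moves x ->
    winning_strategy (fun g => s (s [::] :: g)) i (next x (s [::])) ->
  winning_strategy s i x.
Proof.
move=> tx m0 w [|a h] /=.
  by move=> _ _; split=> // m; rewrite m in m0.
by case/andP=> _ lh /followsS[/(_ tx) Ea]; rewrite {a}Ea in lh *; apply: w.
Qed.

Lemma winning_there s i x : turn x = opponent i ->
    (forall a, a \in moves x ->
       winning_strategy (fun g => s (a :: g)) i (next x a)) ->
  winning_strategy s i x.
Proof.
move=> tx w [|a h] /=.
  by move=> _ _; split=> // ti; rewrite ti in tx; case: (opponent_neq tx).
by case/andP=> ma lh /followsS[_ fh]; apply: w.
Qed.

Theorem determined x : {i : player & {s : strategy | winning_strategy s i x}}.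
Proof.
have [m] := ubnP (measure x); elim: m x => // m IH x lt_xm.
have {}IH a : a \in moves x ->
    {i : player & {s : strategy | winning_strategy s i (next x a)}}.
  by move=> ma; apply: IH; apply: leq_trans (measure_next ma) _.
have sub (l : seq nat) : {subset l <= moves x} ->
    {a & {s | a \in moves x /\ winning_strategy s (turn x) (next x a)}} +
    {s : strategy | forall a, a \in l ->
       winning_strategy (fun g => s (a :: g)) (opponent (turn x)) (next x a)}.
  elim: l => [|a l IHl] sl; first by right; exists (fun=> 0).
  have ma: a \in moves x by apply: sl; rewrite mem_head.
  case: IHl => [b bl | H | [s ws]]; [by apply: sl; rewrite inE bl orbT | by left |].
  have [i [t wt]] := IH a ma.
  have [ei | ni] := eqVneq i (turn x).
    by left; exists a, t; rewrite -ei.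
  right; exists (fun g => if g is b :: g' then if b == a then t g' else s g else 0).
  move=> b; rewrite inE; have [-> _ | _ /ws//] := eqVneq b a.
  by rewrite -(neq_opponent (elimN eqP ni)).
case: (sub (moves x)) => // [[a [s [ma ws]]] | [s ws]].
  exists (turn x), (fun g => if g is _ :: g' then s g' else a).
  exact: winning_here.
exists (opponent (turn x)), s; apply: winning_there ws.
by case: (turn x).
Qed.

(* [determined] is opaque; [winnerP] below characterizes the winner. *)
Definition winner x : player := tag (determined x).

Lemma winning_unique s t i j x :
  winning_strategy s i x -> winning_strategy t j x -> i = j.
Proof.
have [m] := ubnP (measure x); elim: m => // m IH in s t x * => lt_xm ws wt.
have [-> // | /eqP/neq_opponent ij] := eqVneq i j.
have nofollow r k : follows r k x [::] by case.
have [es0 es1] := ws [::] isT (nofollow _ _).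
have [et0 et1] := wt [::] isT (nofollow _ _).
have [m0 | mn0] := eqVneq (moves x) [::].
  by apply: (can_inj (f := opponent) (g := opponent)); [case | rewrite -es1 // et1].
have step a : a \in moves x -> (turn x = i -> a = s [::]) ->
    (turn x = j -> a = t [::]) -> i = j.
  move=> ma ea eb; apply: (IH _ _ (next x a)) (winning_next ws ma ea) (winning_next wt ma eb).
  exact: leq_trans (measure_next ma) _.
have [ti | /eqP/neq_opponent] := eqVneq (turn x) i.
  apply: (step (s [::])) => //; first by apply: es0 => //; apply/eqP.
  by rewrite ti ij => ej; case: (@opponent_neq j).
move=> ti; have tj: turn x = j by rewrite ti ij; case: (j).
apply: (step (t [::])) => //; first by apply: et0 => //; apply/eqP.
by rewrite tj ij => /opponent_neq.
Qed.

Lemma winnerP x i : winner x = i <-> exists s, winning_strategy s i x.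
Proof.
rewrite /winner; case: (determined x) => j [s ws] /=.
by split=> [<- | [t wt]]; [exists s | apply: winning_unique ws wt].
Qed.

End Strategies.

Record move_set := MoveSet {
  amounts :> seq nat;
  amounts_neq0 : amounts != [::];
  amounts_gt0 : all (fun a => 0 < a) amounts
}.

Section Nim.
Variable A : move_set.

(* (the player to move, the number of stones) *)
Definition nim_position : Type := (player * nat)%type.

Definition nim_moves (x : nim_position) : seq nat := [seq a <- A | a <= x.2].

Definition nim_next (x : nim_position) (a : nat) : nim_position :=
  (opponent x.1, x.2 - a).

Lemma sub_lt_amount n a : a \in amounts A -> a <= n -> n - a < n.
Proof.
move=> /(allP (amounts_gt0 A)) a0 an.
by rewrite ltn_subrL a0 (leq_trans a0 an).
Qed.

Lemma nim_measure x a : a \in nim_moves x -> (nim_next x a).2 < x.2.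
Proof. by rewrite mem_filter => /andP[an aA]; apply: sub_lt_amount. Qed.

Definition nim : game :=
  @Game nim_position fst nim_moves nim_next snd (fun _ _ => erefl) nim_measure.

Definition W (n : nat) : player := winner (G := nim) (Player1, n).

(* [dollars1] and [dollars2] belong to Player1 and Player2, whoever is to
   move. *)
Record cash_position := CashPosition {
  mover : player;
  stones : nat;
  dollars1 : nat;
  dollars2 : nat
}.

Definition purse (x : cash_position) : nat :=
  if mover x is Player1 then dollars1 x else dollars2 x.

Definition cash_moves (x : cash_position) : seq nat :=
  [seq a <- A | (a <= stones x) && (a <= purse x)].

Definition cash_next (x : cash_position) (a : nat) : cash_position :=
  match mover x with
  | Player1 => CashPosition Player2 (stones x - a) (dollars1 x - a) (dollars2 x)
  | Player2 => CashPosition Player1 (stones x - a) (dollars1 x) (dollars2 x - a)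
  end.

Lemma cash_turn x a : mover (cash_next x a) = opponent (mover x).
Proof. by rewrite /cash_next; case: (mover x). Qed.

Lemma cash_measure x a : a \in cash_moves x -> stones (cash_next x a) < stones x.
Proof.
rewrite mem_filter -andbA => /and3P[an _ aA].
by rewrite /cash_next; case: (mover x); apply: sub_lt_amount.
Qed.

Definition nim_cash : game :=
  @Game cash_position mover cash_moves cash_next stones cash_turn cash_measure.

Definition Wcash (n d e : nat) : player :=
  winner (G := nim_cash) (CashPosition Player1 n d e).

Definition minseq (s : seq nat) : nat :=
  if s is x :: s' then foldr minn x s' else 0.

(* The pair (U_1(n), U_2(n)), given the pairs U m for m < n. *)
Definition upper_step (U : nat -> nat * nat) (n : nat) : nat * nat :=
  if n < minseq A then (0, 0) else
  let u2 := \max_(a <- A | a <= n) (U (n - a)).1 in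
  match W n with
  | Player1 =>
      (minseq [seq (U (n - a)).2 + a | a <- A & (a <= n) && (W (n - a) == Player2)],
       u2)
  | Player2 =>
      (minseq [seq (U (n - a)).2 + a | a <- A & (a <= n) && ((U (n - a)).1 == u2)],
       u2)
  end.

Fixpoint upper_rec (fuel n : nat) : nat * nat :=
  if fuel is f.+1 then upper_step (upper_rec f) n else (0, 0).

Definition upper (n : nat) : nat * nat := upper_rec n.+1 n.
Definition U1 (n : nat) : nat := (upper n).1.
Definition U2 (n : nat) : nat := (upper n).2.

Lemma upper_step_ext U V n :
  (forall m, m < n -> U m = V m) -> upper_step U n = upper_step V n.
Proof.
move=> UV; rewrite /upper_step.
have E a : a \in amounts A -> a <= n -> U (n - a) = V (n - a).
  by move=> aA an; apply/UV/sub_lt_amount.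
have Emax : \max_(a <- A | a <= n) (U (n - a)).1 =
            \max_(a <- A | a <= n) (V (n - a)).1.
  rewrite big_seq_cond [RHS]big_seq_cond.
  by apply: eq_bigr => a /andP[aA an]; rewrite E.
rewrite Emax; case: ifP => // _.
have Emap (P Q : pred nat) : {in amounts A, forall a, (a <= n) && P a = (a <= n) && Q a} ->
    [seq (U (n - a)).2 + a | a <- A & (a <= n) && P a] =
    [seq (V (n - a)).2 + a | a <- A & (a <= n) && Q a].
  move=> PQ; rewrite -(eq_in_filter PQ); apply/eq_in_map => a.
  by rewrite mem_filter => /andP[/andP[an _] aA]; rewrite E.
case: (W n); congr (minseq _, _); apply: Emap => // a aA.
by case: (boolP (a <= n)) => //= an; rewrite E.
Qed.

Lemma upper_rec_fuel f g n : n < f -> n < g -> upper_rec f n = upper_rec g n.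
Proof.
elim: f g n => [|f IH] [|g] n //= nf ng.
apply: upper_step_ext => m mn.
by apply: IH; [apply: leq_trans mn nf | apply: leq_trans mn ng].
Qed.

Lemma upperE n : upper n = upper_step upper n.
Proof. by apply: upper_step_ext => m mn; apply: upper_rec_fuel. Qed.

End Nim.

(* All divisions are exact. *)
Definition M1 (n : nat) : nat := if odd n then n.+1 %/ 2 else n %/ 2 + 1.
Definition M2 (n : nat) : nat := if odd n then n.+1 %/ 2 else n %/ 2.

Definition A123 : move_set := @MoveSet [:: 1; 2; 3] isT isT.

(* Main.v *)
Require Import Defs.
From mathcomp Require Import all_boot.
From mathcomp Require Import zify.

(** The middle class plays no special role: with [A = {1, 2, 3}], the player to
move holding [d] dollars against [e] beats him from [n] stones if and only if
[e < d] or [U_1(n) <= d] when [4] does not divide [n], and if and only if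
[e < d] and [e < U_2(n)] when [4] divides [n].  This closed form satisfies the
recursion "some move leads to a position which the opponent, then to move,
does not win", because [U_1(n) = 3q + r] and [U_2(n) = 3q + max(r - 1, 0)] for
[n = 4q + r]. *)

Lemma neq_player (i j : player) : (i != j) = (i == opponent j).
Proof. by case: i; case: j. Qed.

(** Both games are solved through this one-step recursion. A winning strategy is cut after its first
    move by [winning_next]; conversely, [winning_here] puts a good move in front of a strategy for
    the position it reaches. *)
Lemma winner_turnE (G : game) (x : G) :
  (winner x == turn x) = has (fun a => winner (Defs.next x a) != turn (Defs.next x a)) (moves x).
Proof.
apply/eqP/hasP => [/winnerP[s ws] | [a ma]].
  have nofollow : follows s (turn x) x [::] by case.
  have [s0 lost] := ws [::] isT nofollow.
  have m0 : s [::] \in moves x.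
    by apply: s0 => //= mx; case: (@opponent_neq (turn x)); apply: lost.
  exists (s [::]) => //; rewrite neq_player turn_next.
  have -> : winner (Defs.next x (s [::])) = turn x.
    by apply/winnerP; eexists; apply: winning_next ws m0 _.
  by case: (turn x).
rewrite turn_next neq_player => /eqP Ewin.
have /winnerP[s ws] : winner (Defs.next x a) = turn x by rewrite Ewin; case: (turn x).
apply/winnerP; exists (fun h => if h is _ :: h' then s h' else a).
exact: winning_here.
Qed.

Lemma winner_nim123 (p : player) (n : nat) :
  (winner (G := nim A123) (p, n) == p) = (n %% 4 != 0).
Proof.
have [m] := ubnP n; elim: m => // m IH in p n * => lt_nm.
rewrite (winner_turnE (nim A123) (p, n)) has_filter /= -has_filter.
have step a : 0 < a <= n ->
    (winner (G := nim A123) (nim_next (p, n) a) != opponent p) = ((n - a) %% 4 == 0).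
  by move=> an; rewrite /nim_next IH ?negbK /=; lia.
apply/hasP/idP => [[a] | n0].
  rewrite mem_filter /= !inE => /andP[an a123].
  by rewrite step; lia.
(* The winning move is the residue [n %% 4], which leaves a multiple of [4]. *)
have a0 : 0 < n %% 4 <= n by lia.
exists (n %% 4); last by rewrite step //; lia.
by rewrite mem_filter !inE /=; lia.
Qed.

Lemma W123 (n : nat) : W A123 n = if n %% 4 == 0 then Player2 else Player1.
Proof.
have := winner_nim123 Player1 n; rewrite /W.
by case: (n %% 4 == 0); case: (winner _).
Qed.

Lemma upper123 (n : nat) :
  upper A123 n = (3 * (n %/ 4) + n %% 4, 3 * (n %/ 4) + (n %% 4).-1).
Proof.
have [m] := ubnP n; elim: m => // m IH in n * => lt_nm.
rewrite upperE.
rewrite (@upper_step_ext _ _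
  (fun k => (3 * (k %/ 4) + k %% 4, 3 * (k %/ 4) + (k %% 4).-1))); last first.
  by move=> k lt_kn; apply: IH; apply: leq_trans lt_kn _.
have W2 k : (W A123 k == Player2) = (k %% 4 == 0) by rewrite W123; case: ifP.
rewrite /upper_step W123.
(* Below [3] stones some moves are illegal; from [3] on all are legal and only the residue
   matters. *)
case: n {lt_nm} => [|[|[|n]]].
- by [].
- by rewrite !big_cons big_nil /= !W2.
- by rewrite !big_cons big_nil /= !W2.
rewrite !big_cons big_nil /= !W2.
by do ?case: ifP => ? /=; congr (_, _); lia.
Qed.

Definition cash_win (n d e : nat) : bool :=
  if n %% 4 == 0 then (e < d) && (e < 3 * (n %/ 4))
  else (e < d) || (3 * (n %/ 4) + n %% 4 <= d).

(** Write [n = 4q + r]. If [r > 0] and [d >= 3q + r], removing [r] stones wins: the mover keeps at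
    least [3q], the bound [U_2(4q)]. In the other winning cases removing [1] works: it keeps
    [e <= d - 1], and [e] stays below the opponent's new bound if [4] does not divide [n - 1]. *)
Lemma cash_win_rec (n d e : nat) :
  cash_win n d e =
  has (fun a => ~~ cash_win (n - a) e (d - a))
      [seq a <- [:: 1; 2; 3] | (a <= n) && (a <= d)].
Proof.
(* Moving the legality test into the predicate lets [has] unfold over a literal list. *)
rewrite has_filter -filter_predI -has_filter /= orbF /cash_win.
by do ?case: ifP => ?; lia.
Qed.

Lemma winner_cash123 (x : cash_position) :
  (winner (G := nim_cash A123) x == mover x) =
  cash_win (stones x) (purse x)
    (if mover x is Player1 then dollars2 x else dollars1 x).
Proof.
have [m] := ubnP (stones x); elim: m => // m IH in x * => lt_xm.
rewrite (winner_turnE (nim_cash A123) x) cash_win_rec.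
apply: eq_in_has => a ma /=.
have lt_a : stones (cash_next x a) < m.
  by apply: leq_trans (cash_measure ma) _; rewrite -ltnS.
by rewrite IH //; case: x {ma lt_xm lt_a} => -[].
Qed.

Theorem theorem6p5 :
  forall n d e : nat,
  M1 n <= d < U1 A123 n ->
  M2 n <= e < U2 A123 n ->
  (n = 0 %[mod 4] ->
    (forall k : nat,
      (M1 n + k <= d < M1 n + k + 1 -> e < M2 n + k + 1 ->
         Wcash A123 n d e = Player1) /\
      (M1 n + k <= d < M1 n + k + 1 -> M2 n + k + 1 <= e ->
         Wcash A123 n d e = Player2)) /\
    (U1 A123 n - 1 <= d -> e < U2 A123 n - 1 -> Wcash A123 n d e = Player1) /\
    (U1 A123 n - 1 <= d -> U2 A123 n - 1 <= e -> Wcash A123 n d e = Player2)) /\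
  (n = 1 %[mod 4] \/ n = 3 %[mod 4] ->
    (d < M1 n + 1 -> Wcash A123 n d e = Player2) /\
    (forall k : nat,
      (M1 n + k + 1 <= d < M1 n + k + 2 -> e < M2 n + k + 1 ->
         Wcash A123 n d e = Player1) /\
      (M1 n + k + 1 <= d < M1 n + k + 2 -> M2 n + k + 1 <= e ->
         Wcash A123 n d e = Player2)) /\
    (U1 A123 n - 1 <= d -> Wcash A123 n d e = Player1)) /\
  (n = 2 %[mod 4] ->
    (forall k : nat,
      (M1 n + k <= d < M1 n + k + 1 -> e < M2 n + k + 1 ->
         Wcash A123 n d e = Player1) /\
      (M1 n + k <= d < M1 n + k + 1 -> M2 n + k + 1 <= e ->
         Wcash A123 n d e = Player2)) /\
    (U1 A123 n - 1 <= d -> Wcash A123 n d e = Player1)).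
Proof.
move=> n d e; rewrite /U1 /U2 upper123 /=.
have := winner_cash123 (CashPosition Player1 n d e).
rewrite /= -/(Wcash A123 n d e) => Ewin.
have -> : Wcash A123 n d e = if cash_win n d e then Player1 else Player2.
  by rewrite -Ewin; case: (Wcash _ _ _ _).
(* Under [d < U_1(n)] and [e < U_2(n)] the closed form is just [e < d]. Each bracket fixes the
   integer [d], and the threshold on [e] there is [d] itself. At [d = U_1(n) - 1] with [4] not
   dividing [n], [U_2(n) = d] gives [e < d]. *)
rewrite /cash_win /M1 /M2; case: (n %% 4 =P 0) => n4; case: ifP => n_odd hd he.
all: repeat (split || move=> ?); case: ifP => // hw; exfalso; move: hw hd he; lia.
Qed.
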